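(* Let $\omega$ be a nonempty factor of $D_\infty$, let $\mathrm{Env}(\omega)=E_{m,i}$ with $i\in\{1,2\}$, and let $\mathrm{Env}(\omega)=\mu_1\,\omega\,\mu_2$. Then for every $p\ge1$, $$L(\omega,p)=L(E_{m,i},p)+|\mu_1|.$$
   Context: Let $\sigma$ be the morphism on $\{a,b\}^*$ with $\sigma(a)=ab$, $\sigma(b)=aa$. The Doubling sequence is $D_\infty=x_1x_2x_3\cdots=\sigma^\infty(a)=abaaabab\cdots$, the infinite fixed point of $\sigma$ beginning with $a$. Put $A_m=\sigma^m(a)$ for $m\ge0$ and let $\delta_m$ be the last letter of $A_m$. For $m\ge1$ the envelope words are $E_{m,1}=A_m\delta_m^{-1}$ (i.e. $A_m$ with its last letter removed) and $E_{m,2}=A_{m-1}A_m\delta_m^{-1}$. They are ordered by: $E_{m_1,i_1}\sqsubset E_{m_2,i_2}$ iff $m_1<m_2$, or $m_1=m_2$ and $i_1<i_2$. For a factor $\omega$ of $D_\infty$, $\mathrm{Env}(\omega)$ is the minimal envelope word (under $\sqsubset$) having $\omega$ as a factor. Every factor $\omega$ of $D_\infty$ occurs infinitely often; $\omega_p$ ($p\ge1$) denotes its $p$-th occurrence, occurrences (overlaps allowed) being ordered by starting position, and $L(\omega,p)$ denotes the position of $\omega_p$, i.e. the index of its first letter in $D_\infty=x_1x_2\cdots$. *)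

(* Defs.v *)
From Stdlib Require Import ClassicalEpsilon.
From HB Require Import structures.
From mathcomp Require Import all_boot.
From mathcomp Require Import zify.

Set Implicit Arguments.
Unset Strict Implicit.
Unset Printing Implicit Defensive.

Inductive letter : Type := la | lb.

Definition letter_eqb (c d : letter) : bool :=
  match c, d with la, la | lb, lb => true | _, _ => false end.

Lemma letter_eqP : Equality.axiom letter_eqb.
Proof. by case; case; constructor. Qed.

HB.instance Definition _ := hasDecEq.Build letter letter_eqP.

Definition word : Type := seq letter.

Definition sigma_letter (c : letter) : word :=
  match c with la => [:: la; lb] | lb => [:: la; la] end.

Definition sigma (w : word) : word := flatten (map sigma_letter w).

Definition A (m : nat) : word := iter m sigma [:: la].

(* The letter x_n of D_oo = x_1 x_2 x_3 ..., for n >= 1 (x 0 is a junk value).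
   Each A m is a prefix of A m.+1 and |A n| = 2 ^ n >= n, so the n-th letter of
   sigma^oo(a) can be read off A n; see A_prefix and x_fixpoint. *)
Definition x (n : nat) : letter := nth la (A n) n.-1.

(* The factor x_n x_(n+1) ... x_(n+l-1) of D_oo. *)
Definition D_slice (n l : nat) : word := [seq x k | k <- iota n l].

(* Positions in D_oo start at 1. *)
Definition occurs_at (w : word) (n : nat) : bool :=
  (1 <= n) && (D_slice n (size w) == w).

Definition is_factor (w : word) : Prop := exists n, occurs_at w n.

Definition is_occurrence (w : word) (p n : nat) : Prop :=
  occurs_at w n /\ count (occurs_at w) (iota 1 n) = p.

(* Meaningful for a factor w of D_oo and p >= 1; see LP and E_factor. *)
Definition L (w : word) (p : nat) : nat :=
  epsilon (inhabits 0) (is_occurrence w p).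

(* w delta^-1, where delta is the last letter of w. *)
Definition drop_last (w : word) : word := take (size w).-1 w.

(* The envelope words are the E m i with m >= 1 and i = 1, 2. *)
Definition E (m i : nat) : word :=
  if i == 1 then drop_last (A m) else A m.-1 ++ drop_last (A m).

Definition envelope_index (m i : nat) : Prop := 1 <= m /\ (i = 1 \/ i = 2).

Definition envelope_lt (m1 i1 m2 i2 : nat) : Prop :=
  m1 < m2 \/ (m1 = m2 /\ i1 < i2).

Definition is_Env (w v : word) : Prop :=
  exists m i, [/\ envelope_index m i, v = E m i, infix w v &
    forall m' i', envelope_index m' i' -> infix w (E m' i') ->
      ~ envelope_lt m' i' m i].

(* Meaningful for a factor w of D_oo; see EnvP. *)
Definition Env (w : word) : word := epsilon (inhabits [::]) (is_Env w).

Lemma sigma_cat u v : sigma (u ++ v) = sigma u ++ sigma v.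
Proof. by rewrite /sigma map_cat flatten_cat. Qed.

Lemma iter_sigma_cat m u v :
  iter m sigma (u ++ v) = iter m sigma u ++ iter m sigma v.
Proof. by elim: m => //= m ->; rewrite sigma_cat. Qed.

Lemma size_sigma w : size (sigma w) = 2 * size w.
Proof. by elim: w => //= c w; rewrite /sigma /= size_cat => ->; case: c => /=; lia. Qed.

Lemma size_A m : size (A m) = 2 ^ m.
Proof. by elim: m => //= m IH; rewrite size_sigma IH expnS. Qed.

Lemma A_S m : A m.+1 = A m ++ iter m sigma [:: lb].
Proof. by rewrite /A iterSr -iter_sigma_cat. Qed.

Lemma A_SS m : A m.+2 = A m.+1 ++ A m ++ A m.
Proof. by rewrite A_S iterSr -iter_sigma_cat. Qed.

Lemma nth_A m k j : j < 2 ^ m -> nth la (A (m + k)) j = nth la (A m) j.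
Proof.
move=> jm; elim: k => [|k IH]; first by rewrite addn0.
rewrite addnS A_S nth_cat size_A IH.
by rewrite (leq_trans jm) // leq_exp2l // leq_addr.
Qed.

Lemma x_nth m j : j < 2 ^ m -> x j.+1 = nth la (A m) j.
Proof.
move=> jm; rewrite /x -pred_Sn.
case: (leqP m j.+1) => h.
  by rewrite -(subnKC h) nth_A.
by rewrite -(subnKC (ltnW h)) nth_A // (ltn_trans (ltnSn j)) // ltn_expl.
Qed.

Lemma A_prefix m : A m = D_slice 1 (2 ^ m).
Proof.
apply: (@eq_from_nth _ la); first by rewrite size_map size_iota size_A.
move=> j; rewrite size_A => jm.
by rewrite (nth_map 0) ?size_iota // nth_iota // add1n (x_nth jm).
Qed.

Lemma slice_take n l k : l <= k -> D_slice n l = take l (D_slice n k).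
Proof. by move=> lk; rewrite -map_take take_iota (minn_idPl lk). Qed.

Lemma x_fixpoint n : sigma (D_slice 1 n) = D_slice 1 (2 * n).
Proof.
have nn : n <= 2 ^ n by apply: ltnW; apply: ltn_expl.
have /(congr1 sigma) := cat_take_drop n (A n).
rewrite sigma_cat {1}A_prefix -(slice_take _ nn) => h.
have -> : D_slice 1 (2 * n) = take (2 * n) (A n.+1).
  by rewrite A_prefix -slice_take // expnS leq_mul2l nn orbT.
rewrite [A n.+1](_ : _ = sigma (A n)) // -h take_size_cat //.
by rewrite size_sigma size_map size_iota.
Qed.

Lemma x_shift m j : 0 < j <= 2 ^ m -> x (2 ^ m.+1 + j) = x j.
Proof.
case: j => // j /= jm.
have jm2 : 2 ^ m.+1 + j < 2 ^ m.+2 by rewrite !expnS; lia.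
rewrite addnS (x_nth jm2) A_SS nth_cat size_A ltnNge leq_addr /= addKn.
by rewrite nth_cat size_A jm (x_nth jm).
Qed.

Lemma factor_unbounded w N : is_factor w -> exists2 n, N < n & occurs_at w n.
Proof.
case=> n /andP[n0 /eqP hn].
have [m mE] : {m | m = N + n + size w} by exists (N + n + size w).
have mm : m < 2 ^ m by apply: ltn_expl.
exists (2 ^ m.+1 + n); first by rewrite expnS; lia.
apply/andP; split; first lia.
rewrite -{2}hn; apply/eqP; rewrite /D_slice iotaDl -map_comp.
apply/eq_in_map => j; rewrite mem_iota /= => hj.
by apply: x_shift; lia.
Qed.

Lemma is_occurrence_uniq w p n1 n2 :
  is_occurrence w p n1 -> is_occurrence w p n2 -> n1 = n2.
Proof.
have aux k1 k2 : k1 < k2 -> occurs_at w k2 ->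
    count (occurs_at w) (iota 1 k1) < count (occurs_at w) (iota 1 k2).
  move=> k12 o2; have e : k2 = k1 + (k2 - k1) by lia.
  rewrite [in X in _ < X]e iotaD count_cat.
  rewrite -{1}[count _ _]addn0 ltn_add2l -has_count; apply/hasP.
  by exists k2 => //; rewrite mem_iota; lia.
move=> [o1 c1] [o2 c2]; case: (ltngtP n1 n2) => // h.
  by have := aux _ _ h o2; rewrite c1 c2 ltnn.
by have := aux _ _ h o1; rewrite c1 c2 ltnn.
Qed.

Lemma LP w p : is_factor w -> 1 <= p -> is_occurrence w p (L w p).
Proof.
move=> fw p1; rewrite /L; apply: epsilon_spec.
pose c n := count (occurs_at w) (iota 1 n).
have cS n : c n.+1 = c n + occurs_at w n.+1.
  by rewrite /c -[n.+1]addn1 iotaD count_cat /= addn0 add1n addn1.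
have ex : exists n, p <= c n.
  elim: p {p1} => [|p [n IH]]; first by exists 0.
  have [[//|k] nk ok] := factor_unbounded n fw.
  exists k.+1; rewrite cS ok addn1 ltnS (leq_trans IH) //.
  by rewrite /c -(subnKC (nk : n <= k)) iotaD count_cat leq_addr.
case: (ex_minnP ex) => [[|n]] h hmin; first by move: h; rewrite /c /= leqNgt p1.
have hn : c n < p by rewrite ltnNge; apply/negP => /hmin; rewrite ltnn.
exists n.+1; split; last by move: h; rewrite -/(c n.+1) cS; case: occurs_at; lia.
by move: h; rewrite cS; case: occurs_at => //; lia.
Qed.

Lemma factor_infix_A w n : occurs_at w n -> infix w (drop_last (A (n + size w))).
Proof.
case/andP=> n0 /eqP hn.
have [m mE] : {m | m = n + size w} by exists (n + size w).
rewrite -mE.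
have mm : m < 2 ^ m by apply: ltn_expl.
apply/infixP; exists (D_slice 1 n.-1), (D_slice m ((2 ^ m).-1 - m.-1)).
rewrite /drop_last size_A A_prefix -slice_take ?leq_pred //.
rewrite -[X in _ ++ (X ++ _)]hn.
rewrite /D_slice -!map_cat; congr map.
have -> : (2 ^ m).-1 = n.-1 + (size w + ((2 ^ m).-1 - m.-1)) by lia.
rewrite !iotaD; congr (_ ++ (_ ++ _)); congr iota; lia.
Qed.

Lemma EnvP w : is_factor w -> is_Env w (Env w).
Proof.
case=> n on; apply: epsilon_spec.
pose P k := (3 <= k) && infix w (E (k.-1)./2 (if odd k then 1 else 2)).
have codeK m i : envelope_index m i ->
    ((2 * m + i).-1)./2 = m /\ (if odd (2 * m + i) then 1 else 2) = i.
  by case=> m1 [] ->; rewrite oddD mul2n odd_double /=; split; lia.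
have PE m i : envelope_index m i -> P (2 * m + i) = infix w (E m i).
  move=> mi; rewrite /P; have [-> ->] := codeK _ _ mi.
  by case: mi => m1 [] ->; rewrite (_ : 3 <= _) //; lia.
have m0 : envelope_index (n + size w) 1 by case/andP: on => n0 _; split; [lia | left].
have ex : exists k, P k.
  by exists (2 * (n + size w) + 1); rewrite (PE _ _ m0) /E eqxx factor_infix_A.
case: (ex_minnP ex) => k /andP[k3 hk] kmin.
set m := (k.-1)./2 in hk; set i := (if odd k then 1 else 2) in hk.
have ki : k = 2 * m + i by rewrite /m /i; case: ifP => ok; lia.
have mi : envelope_index m i.
  by split; [rewrite /m; lia | rewrite /i; case: ifP; [left | right]].
exists (E m i), m, i; split=> // m' i' mi' hw'.
have := kmin (2 * m' + i'); rewrite (PE _ _ mi') => /(_ hw').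
case: mi mi' => [? h1] [? h2]; rewrite ki /envelope_lt; lia.
Qed.

Lemma infix_A_factor w n : infix w (A n) -> is_factor w.
Proof.
case/infixP=> u [v e]; exists (size u).+1; rewrite /occurs_at ltn0Sn /=.
have sz : size (u ++ w ++ v) = 2 ^ n by rewrite -e size_A.
rewrite !size_cat in sz; move: e; rewrite A_prefix -sz /D_slice !iotaD !map_cat add1n.
move/eqP; rewrite eqseq_cat ?size_map ?size_iota // => /andP[_].
by rewrite eqseq_cat ?size_map ?size_iota // => /andP[].
Qed.

Lemma E_factor m i : envelope_index m i -> is_factor (E m i).
Proof.
case; case: m => // m _ hi; apply: (@infix_A_factor _ m.+3).
case: hi => ->; rewrite /E; apply/infixP.
  exists (A m.+2 ++ A m.+1), (drop (size (A m.+1)).-1 (A m.+1)).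
  by rewrite [drop_last _ ++ _]cat_take_drop A_SS catA.
exists (A m.+1 ++ A m), (drop (size (A m.+1)).-1 (A m.+1) ++ A m.+1).
have -> : (A m ++ drop_last (A m.+1)) ++
    drop (size (A m.+1)).-1 (A m.+1) ++ A m.+1 = A m ++ A m.+1 ++ A m.+1.
  by rewrite -!catA; congr cat; rewrite catA cat_take_drop.
by rewrite A_SS {1}[A m.+2]A_SS -!catA.
Qed.

(* Main.v *)
(** Desubstitution. Each envelope satisfies [E m.+1 i = sigma (E m i) a], and
    the odd positions of [D_oo] all carry an [a].  A factor other than [a] and
    [aa] has all its occurrences at positions of one parity, so each of them
    extends to a shortest word starting and ending at odd positions, which is
    [sigma v a] for the same factor [v] each time.  Since [w] lies in
    [E m.+1 i] exactly when [v] lies in [E m i], induction on [m] shows that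
    each occurrence of [w] extends to one of its envelope at the given offset. *)
Require Import Defs.
From mathcomp Require Import all_boot.
From mathcomp Require Import zify.

(** * Slices and occurrences *)

Lemma size_slice n l : size (D_slice n l) = l.
Proof. by rewrite size_map size_iota. Qed.

Lemma nth_slice n l t : t < l -> nth la (D_slice n l) t = x (n + t).
Proof. by move=> tl; rewrite (nth_map 0) ?size_iota // nth_iota. Qed.

Lemma slice_cat n k l : D_slice n (k + l) = D_slice n k ++ D_slice (n + k) l.
Proof. by rewrite /D_slice iotaD map_cat. Qed.

Lemma slice_sub n k l j :
  D_slice n (k + (l + j)) = D_slice n k ++ D_slice (n + k) l ++ D_slice (n + k + l) j.
Proof. by rewrite !slice_cat. Qed.

Lemma slice_infix n k r l :
  n <= r -> r + l <= n + k -> infix (D_slice r l) (D_slice n k).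
Proof.
move=> nr rk; apply/infixP.
exists (D_slice n (r - n)), (D_slice (r + l) (n + k - (r + l))).
have -> : k = r - n + (l + (n + k - (r + l))) by lia.
by rewrite slice_sub; congr (_ ++ (D_slice _ _ ++ D_slice _ _)); lia.
Qed.

Lemma occurs_atP (w : word) n : occurs_at w n <-> 0 < n /\ D_slice n (size w) = w.
Proof. by rewrite /occurs_at; split=> [/andP[? /eqP]|[-> /eqP]]. Qed.

Lemma occurs_at_nth (w : word) n t : occurs_at w n -> t < size w -> x (n + t) = nth la w t.
Proof. by move=> /occurs_atP[_ {2}<-] tw; rewrite nth_slice. Qed.

Lemma occurs_at_sub (u w v : word) n :
  occurs_at (u ++ w ++ v) n -> occurs_at w (n + size u).
Proof.
case/andP=> n0; rewrite !size_cat slice_sub eqseq_cat ?size_slice //.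
case/andP=> _; rewrite eqseq_cat ?size_slice // => /andP[ow _].
by rewrite /occurs_at ow andbT; lia.
Qed.

(** * Action of [sigma] on positions, occurrences and envelopes *)

Lemma sigma_slice k j : 0 < k -> sigma (D_slice k j) = D_slice k.*2.-1 j.*2.
Proof.
(* Split the fixed prefix of length [k + j] after [k] letters and cancel the image of the first
   piece. *)
case: k => // k _; have := x_fixpoint (k + j).
rewrite mulnDr [D_slice _ (k + j)]slice_cat [D_slice _ (_ + _)]slice_cat sigma_cat x_fixpoint => /(congr1 (drop (2 * k))).
rewrite !drop_size_cat ?size_slice // !add1n => ->.
by rewrite -!mul2n mulnS.
Qed.

Lemma sigma_x k : 0 < k -> sigma_letter (x k) = [:: x k.*2.-1; x k.*2].
Proof.
move=> k0; have := sigma_slice k 1 k0; rewrite /D_slice /sigma /= cats0 => ->.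
by rewrite prednK // double_gt0.
Qed.

Lemma x_odd n : odd n -> x n = la.
Proof.
move=> on; have k0 : 0 < uphalf n by lia.
have -> : n = (uphalf n).*2.-1 by lia.
by have := sigma_x _ k0; case: (x (uphalf n)) => /= -[].
Qed.

(** The second letter of a block [sigma_letter c] determines [c]. *)
Lemma x_double_inj k k' : 0 < k -> 0 < k' -> x k.*2 = x k'.*2 -> x k = x k'.
Proof.
move=> /sigma_x + /sigma_x + e; rewrite e.
by case: (x k); case: (x k') => //= -[_ <-] [].
Qed.

Lemma sigma_slice_rcons k j :
  0 < k -> sigma (D_slice k j) ++ [:: la] = D_slice k.*2.-1 j.*2.+1.
Proof.
move=> k0; rewrite sigma_slice // -[in RHS]addn1 slice_cat; congr cat.
by rewrite /D_slice /= x_odd //; lia.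
Qed.

Lemma sigma_occurs (e : word) q :
  occurs_at e q -> occurs_at (sigma e ++ [:: la]) q.*2.-1.
Proof.
case/occurs_atP=> q0 qE; apply/occurs_atP; split; first lia.
rewrite size_cat size_sigma /= addn1 mul2n -sigma_slice_rcons //.
by rewrite qE.
Qed.

Lemma sigma_infix (v e : word) :
  infix v e -> infix (sigma v ++ [:: la]) (sigma e ++ [:: la]).
Proof.
case/infixP=> u [z ->]; rewrite !sigma_cat.
(* Whatever follows [sigma v] starts with [la], be it an image or the final letter. *)
have [y zy] : exists y, sigma z ++ [:: la] = la :: y.
  by case: z => [|[] z]; eexists.
by apply/infixP; exists (sigma u), y; rewrite -!catA zy.
Qed.

(** Both blocks begin with [la], so cutting the last block leaves [la] whatever its letter. *)
Lemma drop_last_sigma (u : word) :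
  u <> [::] -> drop_last (sigma u) = sigma (drop_last u) ++ [:: la].
Proof.
case/lastP: u => // u c _.
rewrite /drop_last size_sigma size_rcons succnK -cats1 sigma_cat.
rewrite [in RHS]take_size_cat // take_cat size_sigma.
have -> : (2 * (size u).+1).-1 = 2 * size u + 1 by lia.
by rewrite ltnNge leq_addr /= addKn; case: c.
Qed.

Lemma E_S m i : 0 < m -> E m.+1 i = sigma (E m i) ++ [:: la].
Proof.
case: m => // m _; have A0 : A m.+1 <> [::].
  by move/(congr1 size)/eqP; rewrite size_A expn_eq0.
rewrite /E succnK -[A m.+2]/(sigma (A m.+1)) drop_last_sigma //.
by case: ifP => // _; rewrite catA -sigma_cat.
Qed.

(* Of two consecutive even positions [2k] and [2k + 2], both carrying an [a]
   would force [x k = x k.+1 = lb], but one of [k], [k.+1] is odd. *)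
Lemma even_pair n : 0 < n -> ~~ odd n -> x n = la -> x n.+2 <> la.
Proof.
move=> n0 en; have nE : n = n./2.*2 by lia.
have k0 : 0 < n./2 by lia.
rewrite nE -doubleS => x1 x2.
have := sigma_x _ k0; have := sigma_x _ (ltn0Sn n./2); rewrite x1 x2.
case: (boolP (odd n./2)) => ok; first by rewrite [x n./2]x_odd.
by rewrite [x n./2.+1]x_odd.
Qed.

(** At each offset one of the two positions is odd, so [w] consists of [la] only; a length of three
    or more would contradict [even_pair] at the even one of [n] and [r]. *)
Lemma occurs_parity (w : word) n r :
  occurs_at w n -> occurs_at w r -> odd n != odd r -> infix w [:: la; la].
Proof.
move=> on or nr.
have xa t : t < size w -> x (n + t) = la /\ x (r + t) = la.
  move=> tw; rewrite (occurs_at_nth _ _ _ on tw) (occurs_at_nth _ _ _ or tw).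
  suff -> : nth la w t = la by [].
  case: (boolP (odd (n + t))) => ont.
    by rewrite -(occurs_at_nth _ _ _ on tw) x_odd.
  by rewrite -(occurs_at_nth _ _ _ or tw) x_odd //; lia.
have [n0 _] := proj1 (occurs_atP _ _) on.
have [r0 _] := proj1 (occurs_atP _ _) or.
have w2 : size w <= 2.
  rewrite leqNgt; apply/negP => w3.
  have [] := xa 0 (ltn_trans (isT : 0 < 2) w3); have [] := xa 2 w3.
  rewrite !addn0 !addn2 => n2 r2 n1 r1.
  case: (boolP (odd n)) => o; first by apply: (even_pair r) => //; lia.
  exact: (even_pair n).
have -> : w = nseq (size w) la.
  apply: (@eq_from_nth _ la); first by rewrite size_nseq.
  move=> t tw; rewrite -(occurs_at_nth _ _ _ on tw) nth_nseq tw.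
  by have [] := xa t tw.
by case: (size w) w2 => [|[|[]]].
Qed.

(** Minimality is a hypothesis on [m] and [i], not phrased through [Env], so that the induction can
    pass it on to the preimage [v]. *)
Lemma extends_to_envelope m i (w mu1 mu2 : word) n :
  envelope_index m i -> w <> [::] ->
  (forall m' i', envelope_index m' i' -> infix w (E m' i') ->
     ~ envelope_lt m' i' m i) ->
  E m i = mu1 ++ w ++ mu2 -> occurs_at w n ->
  size mu1 < n /\ occurs_at (E m i) (n - size mu1).
Proof.
elim: m i w mu1 mu2 n => [|m IH] i w mu1 mu2 n [] // _ hi w0 wmin wE on.
have [n0 _] := proj1 (occurs_atP _ _) on.
have sw : 0 < size w by case: w w0 {wmin wE on}.
have aE : E 1 1 = [:: la] by [].
have aaE : E 1 2 = [:: la; la] by [].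
case: m => [|m] in IH wmin wE *.
  (* At the first level minimality forces [w] to be the whole envelope. *)
  suff wsz : size (E 1 i) <= size w.
    have := congr1 size wE; rewrite !size_cat => szE.
    have mu10 : mu1 = [::] by apply: size0nil; lia.
    have mu20 : mu2 = [::] by apply: size0nil; lia.
    by rewrite wE mu10 mu20 cats0 subn0.
  case: hi => ?; subst i; rewrite ?aE ?aaE //=.
  rewrite ltn_neqAle sw andbT; apply/eqP => w1.
  apply: (wmin 1 1); [by split; auto | | by right; split].
  have -> : w = [:: la]; last by [].
  apply: (@eq_from_nth _ la); first by rewrite -w1.
  rewrite -w1 => -[] // _.
  have := congr1 (nth la ^~ (size mu1)) wE; rewrite aaE.
  rewrite nth_cat ltnn subnn nth_cat sw => <-.
  by case: (size mu1) => [|[|[]]].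
have nsmall : ~ infix w [:: la; la].
  by rewrite -aaE => hw; apply: (wmin 1 2) => //; [split; auto | left].
have mi : envelope_index m.+1 i by [].
set e := E m.+1 i in IH wE *.
have {}wE : sigma e ++ [:: la] = mu1 ++ w ++ mu2 by rewrite -E_S.
rewrite E_S // -/e.
have [q oq] := E_factor mi; rewrite -/e in oq.
have [q0 qE] := proj1 (occurs_atP _ _) oq.
(* Reference occurrence of [w], at [r], inside an envelope occurrence at [q.*2.-1]. *)
have := sigma_occurs _ _ oq; rewrite {1}wE => /occurs_at_sub.
set r := _ + size mu1 => or.
have rn : odd r = odd n.
  by apply/eqP; apply/negPn/negP => /(occurs_parity _ _ _ or on).
have := congr1 size wE; rewrite !size_cat size_sigma /= => szE.
(* The shortest stretch with odd ends covering [w] at [r] runs from [k.*2.-1] to [(k + j).*2.-1]. *)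
pose k := uphalf r; pose j := uphalf (r + size w) - k.
pose v := D_slice k j.
have [r0 wr] := proj1 (occurs_atP _ _) or.
have kq : q <= k by rewrite /k /r; lia.
have kj : k + j <= q + size e by rewrite /j /k /r; lia.
have wv : infix w (sigma v ++ [:: la]).
  rewrite sigma_slice_rcons; last lia.
  by rewrite -wr; apply: slice_infix; rewrite /j /k; lia.
have v0 : v <> [::].
  by move=> vE; apply: nsmall; apply: infix_trans wv _; rewrite vE.
have vE : e = D_slice q (k - q) ++ v ++ D_slice (k + j) (q + size e - (k + j)).
  rewrite -{1}qE; have {1}-> : size e = (k - q) + (j + (q + size e - (k + j))) by lia.
  by rewrite slice_sub subnKC.
(* A smaller envelope containing [v] would have as image a smaller envelope containing [w]. *)
have vmin m' i' : envelope_index m' i' -> infix v (E m' i') ->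
    ~ envelope_lt m' i' m.+1 i.
  move=> mi' /sigma_infix; rewrite -E_S; last by case: mi'.
  move=> /(infix_trans wv) wE' lt.
  apply: (wmin m'.+1 i') => //; first by case: mi'.
  by case: lt => [|[-> ?]]; [left | right].
pose k' := uphalf n.
have ov : occurs_at v k'.
  apply/occurs_atP; split; first by rewrite /k'; lia.
  rewrite size_slice; apply: (@eq_from_nth _ la); first by rewrite !size_slice.
  rewrite size_slice => t tj; rewrite !nth_slice //.
  apply: x_double_inj; [by rewrite /k'; lia | by lia |].
  (* The even positions that determine [v] all lie inside [w]; equal parity of [n] and [r] keeps
     them even at [n]. *)
  have tw : (k + t).*2 - r < size w by rewrite /k; move: tj; rewrite /j /k; lia.
  have := occurs_at_nth _ _ _ or tw; rewrite -(occurs_at_nth _ _ _ on tw).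
  have -> : r + ((k + t).*2 - r) = (k + t).*2 by rewrite /k; lia.
  by have -> : n + ((k + t).*2 - r) = (k' + t).*2 by [rewrite /k' /k; lia].
have [] := IH i v _ _ k' mi v0 vmin vE ov; rewrite size_slice => kk' /sigma_occurs.
have -> : (k' - (k - q)).*2.-1 = n - size mu1.
  by move: kk'; rewrite /k' /k /r in rn *; lia.
by move=> ->; split=> //; move: kk'; rewrite /k' /k /r in rn *; lia.
Qed.

Theorem proposition6p3 (w : word) (m i : nat) (mu1 mu2 : word) (p : nat) :
  is_factor w ->
  w <> [::] ->
  envelope_index m i ->
  Env w = E m i ->
  Env w = mu1 ++ w ++ mu2 ->
  1 <= p ->
  L w p = L (E m i) p + size mu1.
Proof.
move=> fw w0 mi EnvE wE p1; set s := size mu1.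
have occE n : occurs_at w n -> s < n /\ occurs_at (E m i) (n - s).
  (* The minimal indices [m0], [i0] are tied to [m], [i] only through equality of the envelope
     words, which suffices. *)
  have [m0 [i0 [mi0 E0 _ wmin]]] := EnvP fw.
  move=> on; rewrite -EnvE E0.
  by apply: extends_to_envelope on => //; rewrite -E0 wE.
have Eocc n : occurs_at (E m i) n -> occurs_at w (n + s).
  by rewrite -EnvE wE => /occurs_at_sub.
have [oL cL] := LP (E_factor mi) p1.
apply: (is_occurrence_uniq (LP fw p1)); split; first exact: Eocc.
(* No [w] starts in the first [s] positions; beyond them, shifting by [s] matches the occurrences of
   [E m i] and [w]. *)
rewrite -[RHS]cL addnC iotaD count_cat.
have -> : count (occurs_at w) (iota 1 s) = 0.
  apply/eqP; rewrite -leqn0 leqNgt -has_count; apply/hasPn => n.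
  rewrite mem_iota => ns; apply/negP => /occE[]; lia.
rewrite add0n addnC iotaDl count_map; apply: eq_in_count => n.
rewrite mem_iota => n1 /=; apply/idP/idP.
  by case/occE=> _; rewrite addKn.
by rewrite addnC; apply: Eocc.
Qed.
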